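(* Fix $C\ge1$. Let $N,M:(0,1]\to\mathbb{N}$ be functions with $N(\delta)\to\infty$ as $\delta\to0^+$ and $$\lim_{\delta\to0^+}\frac{N(C\delta)}{\log\bigl(\delta^{-1}M(\delta)\bigr)}=+\infty.$$ Let $\mathcal{F}$ be a family of functions $[0,1]^d\to\mathbb{R}^d$ such that (I) $C^{-1}\|x-y\|_\infty\le\|f(x)-f(y)\|_\infty\le\|x-y\|_\infty$ for all $x,y\in[0,1]^d$ and all $f\in\mathcal{F}$; (II) $|\mathcal{F}|_\delta\le M(\delta)$ for all sufficiently small $\delta>0$. Then for every $N$-large set $A\subset[0,1]^d$ there exists a compact set $B\subset\mathbb{R}^d$ with $|B|=0$ such that $[0,1]^d\subset f(A)+B$ for all $f\in\mathcal{F}$.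
   Context: $|\mathcal{F}|_\delta$ is the covering number of $\mathcal{F}$ in the $L^\infty([0,1]^d)$ norm: the least $M$ such that there exist $f_1,\dots,f_M\in\mathcal{F}$ with $\min_i\|f-f_i\|_{L^\infty([0,1]^d)}\le\delta$ for all $f\in\mathcal{F}$ ($\infty$ if none exists). For $E\subset\mathbb{R}^d$, $|E|_\delta$ is the smallest number of balls of radius $\delta$ covering $E$. For $N:(0,1]\to\mathbb{N}$ with $N(\delta)\to\infty$, a Borel set $A$ is $N$-large if there is a nonempty compact $A'\subset A$ such that for every (closed, axis-parallel) cube $Q$ with $A'\cap Q^\circ\neq\emptyset$ ($Q^\circ$ the interior), $\limsup_{\delta\to0^+}|A'\cap Q^\circ|_\delta/N(\delta)\ge1$. $|B|$ is Lebesgue measure. *)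

(* Defs.v *)
(* Points of R^d are row vectors 'rV[R]_d; the
   library norm `|x| on 'rV[R]_d is the sup norm ||x||_oo (mx_norm). *)
From HB Require Import structures.
From mathcomp Require Import all_boot all_order all_algebra.
From mathcomp Require Import all_classical all_reals all_analysis.
Set Implicit Arguments. Unset Strict Implicit. Unset Printing Implicit Defensive.
Import Order.TTheory GRing.Theory Num.Theory.
Import numFieldNormedType.Exports.
Local Open Scope classical_set_scope.
Local Open Scope ring_scope.

Definition unit_cube {R : realType} (d : nat) : set 'rV[R]_d :=
  [set x | forall i : 'I_d, 0 <= x ord0 i <= 1].
Arguments unit_cube {R} d.

Definition closed_cube {R : realType} (d : nat) (a : 'rV[R]_d) (s : R)
  : set 'rV[R]_d :=
  [set x | forall i : 'I_d, a ord0 i <= x ord0 i <= a ord0 i + s].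

Definition borel_set {R : realType} (d : nat) (A : set 'rV[R]_d) : Prop :=
  <<s [set U : set 'rV[R]_d | open U] >> A.

Definition euclid_ball {R : realType} (d : nat) (c : 'rV[R]_d) (r : R)
  : set 'rV[R]_d :=
  [set x | Num.sqrt (\sum_(i < d) (x ord0 i - c ord0 i) ^+ 2) <= r].

Definition covered_by_balls {R : realType} (d : nat) (E : set 'rV[R]_d)
  (delta : R) (k : nat) : Prop :=
  exists c : 'I_k -> 'rV[R]_d,
    E `<=` [set x | exists i : 'I_k, euclid_ball (c i) delta x].

(* |E|_delta (+oo if no finite cover) *)
Definition ball_covnum {R : realType} (d : nat) (E : set 'rV[R]_d) (delta : R)
  : \bar R :=
  ereal_inf [set (k%:R)%:E | k in [set k | covered_by_balls E delta k]].

Definition fam_covered_by {R : realType} (d : nat)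
  (F : set ('rV[R]_d -> 'rV[R]_d)) (delta : R) (k : nat) : Prop :=
  exists fs : 'I_k -> ('rV[R]_d -> 'rV[R]_d),
    (forall i, F (fs i)) /\
    forall f, F f -> exists i : 'I_k,
      forall x, unit_cube d x -> `|f x - fs i x| <= delta.

(* |F|_delta (+oo if none exists) *)
Definition fam_covnum {R : realType} (d : nat)
  (F : set ('rV[R]_d -> 'rV[R]_d)) (delta : R) : \bar R :=
  ereal_inf [set (k%:R)%:E | k in [set k | fam_covered_by F delta k]].

(* limsup_{delta -> 0+} g(delta) >= 1, g defined on (0,1] *)
Definition limsup_at0_ge1 {R : realType} (g : R -> \bar R) : Prop :=
  forall eps : R, 0 < eps -> forall eta : R, 0 < eta ->
    exists delta : R, 0 < delta < eta /\ delta <= 1 /\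
      ((1 - eps)%:E < g delta)%E.

Definition N_large {R : realType} (d : nat) (N : R -> nat) (A : set 'rV[R]_d)
  : Prop :=
  exists A' : set 'rV[R]_d,
    [/\ compact A', A' !=set0, A' `<=` A &
      forall (a : 'rV[R]_d) (s : R), 0 < s ->
        (A' `&` interior (closed_cube a s)) !=set0 ->
        limsup_at0_ge1 (fun delta =>
          (ball_covnum (A' `&` interior (closed_cube a s)) delta
             * ((N delta)%:R^-1)%:E)%E)].

Definition lebesgue_null {R : realType} (d : nat) (B : set 'rV[R]_d) : Prop :=
  forall eps : R, 0 < eps ->
    exists a b : nat -> 'rV[R]_d,
      [/\ forall k (i : 'I_d), a k ord0 i <= b k ord0 i,
          B `<=` [set x | exists k, forall i : 'I_d,
                         a k ord0 i <= x ord0 i <= b k ord0 i] &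
          (\sum_(0 <= k <oo) (\prod_(i < d) (b k ord0 i - a k ord0 i))%:E
             <= eps%:E)%E].

(* Main.v *)
(* B is built by successive approximation, keeping a finite list of cubes Q
   meeting the compact large part A' of A, such that for all f in F and z in
   the unit cube some Q of the list has z - f(A' `&` Q°) inside the current
   finite union D of closed cubes.  To refine one Q, take a scale delta with
   |A' `&` Q°|_(C delta) > N(C delta) / 2 and cut space into cells of side
   delta / d.  Since f^-1 is C-Lipschitz, z - f(A' `&` Q°) meets at least
   N(C delta) / 2 cells, so a greedy choice of a proportion of about
   ln (M(delta) delta^-d) / N(C delta) -> 0 of the cells hits all these sets,
   for f and z ranging over delta-nets.  Enlarging the chosen cells by 3 delta
   absorbs the passage from the nets to all f and z, and only multiplies the
   volume by a constant.  Each Q has its own good scales (limsup, not lim), but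
   D may be taken as the union over the list.  B is the intersection of all
   the D's. *)

Require Import Defs.
From HB Require Import structures.
From mathcomp Require Import all_boot all_order all_algebra.
From mathcomp Require Import all_classical all_reals all_analysis.
From mathcomp Require Import ring lra.
Set Implicit Arguments. Unset Strict Implicit. Unset Printing Implicit Defensive.
Import Order.TTheory GRing.Theory Num.Theory.
Import numFieldNormedType.Exports.
Local Open Scope classical_set_scope.
Local Open Scope ring_scope.

(** * Sup norm, finite unions of closed cubes and null sets *)

Lemma coord_le_norm (R : realType) (d : nat) (x : 'rV[R]_d) (i : 'I_d) :
  `|x ord0 i| <= `|x|.
Proof.
rewrite [leRHS]/Num.Def.normr /= mx_normrE.
by apply/bigmax_geP; right; exists (ord0, i).
Qed.

Lemma norm_le_coord (R : realType) (d : nat) (x : 'rV[R]_d) (r : R) :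
  0 <= r -> (forall i, `|x ord0 i| <= r) -> `|x| <= r.
Proof.
move=> r0 xr; rewrite [leLHS]/Num.Def.normr /= mx_normrE.
by apply/bigmax_leP; split => // -[i j] _ /=; rewrite ord1.
Qed.

(** The Euclidean norm is at most [d] times the sup norm. This crude factor is the reason for cells
    of side [delta / d] later on. *)
Lemma norm_le_euclid_ball (R : realType) (d : nat) (c x : 'rV[R]_d) (r : R) :
  (0 < d)%N -> `|x - c| <= r / d%:R -> euclid_ball c r x.
Proof.
move=> d0 xcr; rewrite /euclid_ball /=.
have dR : 0 < d%:R :> R by rewrite ltr0n.
have r0 : 0 <= r.
  by have := le_trans (normr_ge0 _) xcr; rewrite pmulr_lge0 // invr_gt0.
rewrite -[leRHS]ger0_norm // -sqrtr_sqr ler_wsqrtr //.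
have le1 (i : 'I_d) : (x ord0 i - c ord0 i) ^+ 2 <= (r / d%:R) ^+ 2.
  have H := le_trans (coord_le_norm (x - c) i) xcr; rewrite !mxE in H.
  rewrite -[leLHS]real_normK ?num_real // lerXn2r ?nnegrE //.
  exact: le_trans H.
apply: le_trans (ler_sum _ (fun i _ => le1 i)) _.
rewrite sumr_const card_ord -[leLHS]mulr_natr expr_div_n -mulrA ler_piMr ?sqr_ge0 //.
rewrite expr2 invfM -mulrA mulVf ?mulr1 ?gt_eqF //.
by rewrite -[leRHS]invr1 lef_pV2 ?posrE // ler1n.
Qed.

Definition cubes_union (R : realType) (d : nat) (L : seq ('rV[R]_d * R)) :
  set 'rV[R]_d := [set x | exists2 q, q \in L & closed_cube q.1 q.2 x].

Lemma cubes_union_cat (R : realType) (d : nat) (L1 L2 : seq ('rV[R]_d * R)) :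
  cubes_union (L1 ++ L2) = cubes_union L1 `|` cubes_union L2.
Proof.
rewrite predeqE => x; split=> [[q]|[[q qL qx]|[q qL qx]]].
- by rewrite mem_cat => /orP[] qL qx; [left|right]; exists q.
- by exists q; rewrite // mem_cat qL.
- by exists q; rewrite // mem_cat qL orbT.
Qed.

Lemma closed_cube_compact (R : realType) (d : nat) (a : 'rV[R]_d) (s : R) :
  compact (closed_cube a s).
Proof.
apply: (@rV_compact _ _
  (fun i => [set` `[a ord0 i, a ord0 i + s]] : set R)).
by move=> i; exact: segment_compact.
Qed.

Lemma cubes_union_compact (R : realType) (d : nat) (L : seq ('rV[R]_d * R)) :
  compact (cubes_union L).
Proof.
elim: L => [|q L IH].
  rewrite (_ : cubes_union _ = set0); first exact: compact0.
  by rewrite predeqE => x; split => // -[].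
rewrite -cat1s cubes_union_cat; apply: compactU => //.
rewrite (_ : cubes_union _ = closed_cube q.1 q.2).
  exact: closed_cube_compact.
rewrite predeqE => x; split=> [[p]|qx]; first by rewrite inE => /eqP ->.
by exists q; rewrite // inE.
Qed.

Lemma cubes_union_closed (R : realType) (d : nat) (L : seq ('rV[R]_d * R)) :
  closed (cubes_union L).
Proof.
apply: compact_closed; last exact: cubes_union_compact.
exact: norm_hausdorff.
Qed.

(** Indices past the end of [s] contribute [g x0 = 0]; this bounds the partial sums when a finite
    list is read as a sequence. *)
Lemma sum_nth_le (R : numDomainType) (T : Type) (x0 : T) (g : T -> R)
    (s : seq T) (n : nat) :
  g x0 = 0 -> (forall x, 0 <= g x) ->
  \sum_(0 <= k < n) g (nth x0 s k) <= \sum_(x <- s) g x.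
Proof.
move=> g0 gge0; elim: s n => [|x s IH] [|n].
- by rewrite !big_nil.
- by rewrite [leRHS]big_nil big1 // => k _; rewrite nth_nil.
- by rewrite big_geq // sumr_ge0.
- by rewrite big_nat_recl //= big_cons lerD2l.
Qed.

Lemma lebesgue_null_cubes (R : realType) (d : nat) (B : set 'rV[R]_d) :
  (0 < d)%N ->
  (forall eps : R, 0 < eps -> exists L : seq ('rV[R]_d * R),
     [/\ all (fun q => 0 <= q.2) L, B `<=` cubes_union L &
         \sum_(q <- L) q.2 ^+ d <= eps]) ->
  lebesgue_null B.
Proof.
move=> d0 HB eps eps0; have [L [L0 BL Lvol]] := HB _ eps0.
(* The list is continued by degenerate cubes, of volume [0 ^+ d = 0] since [0 < d]. *)
pose q0 : 'rV[R]_d * R := (0, 0).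
have Lk k : 0 <= (nth q0 L k).2.
  have [kL|kL] := ltnP k (size L); last by rewrite nth_default.
  by apply: (allP L0); rewrite mem_nth.
exists (fun k => (nth q0 L k).1).
exists (fun k => (nth q0 L k).1 + const_mx (nth q0 L k).2).
split=> [k i|x /BL [q qL qx]|].
- by rewrite !mxE lerDl.
- exists (index q L) => i; rewrite !mxE nth_index //; exact: qx.
have volE k : \prod_(i < d) (((nth q0 L k).1 + const_mx (nth q0 L k).2) ord0 i
    - (nth q0 L k).1 ord0 i) = `|(nth q0 L k).2| ^+ d.
  rewrite (eq_bigr (fun=> `|(nth q0 L k).2|)).
    by rewrite prodr_const card_ord.
  by move=> i _; rewrite !mxE addrAC subrr add0r ger0_norm.
apply: lime_le.
  apply: is_cvg_nneseries => k _ _.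
  by rewrite lee_fin volE exprn_ge0.
apply: nearW => n; rewrite sumEFin lee_fin (eq_bigr _ (fun k _ => volE k)).
apply: le_trans (sum_nth_le (x0 := q0) (g := fun q => `|q.2| ^+ d) L n _ _) _.
- by rewrite /q0 /= normr0 expr0n gtn_eqF.
- by move=> q; rewrite exprn_ge0.
apply: le_trans Lvol; rewrite big_seq [leRHS]big_seq ler_sum // => q qL.
by rewrite ger0_norm // (allP L0).
Qed.

(** * Greedy hitting sets in a finite type *)

Lemma finite_bound (R : realType) (I : finType) (g : I -> R) :
  exists2 b, 0 <= b & forall i, g i <= b.
Proof.
exists (\sum_i `|g i|) => [|i]; first by rewrite sumr_ge0.
rewrite (bigD1 i) //= (le_trans (ler_norm _)) // lerDl.
by rewrite sumr_ge0.
Qed.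

(* By double counting, some point lies in a proportion m / #|T| of the sets
   not hit so far. *)
Lemma greedy_hitting (R : realFieldType) (T I : finType) (H : I -> {set T})
    (m : R) (r : nat) (i0 : I) :
  0 < m -> (forall i, m <= #|H i|%:R) ->
  exists2 S : {set T}, (#|S| <= r)%N &
    #|[set i | [disjoint H i & S]]%SET|%:R <=
      #|I|%:R * (1 - m / #|T|%:R) ^+ r :> R.
Proof.
move=> m0 mH.
have mT : m <= #|T|%:R by rewrite (le_trans (mH i0)) // ler_nat max_card.
have T0 : 0 < #|T|%:R :> R by exact: lt_le_trans mT.
elim: r => [|r [S Sr IH]].
  by exists finset.set0; rewrite ?cards0 // expr0 mulr1 ler_nat max_card.
set U := [set i | _]%SET in IH.
pose c t := #|[set i in U | t \in H i]%SET|.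
have [t ct] : exists t, m * #|U|%:R <= #|T|%:R * (c t)%:R :> R.
  (* If every [t] failed, summing the strict inequalities over [T] would contradict the double count
     of pairs [t \in H i] with [i] in [U]. *)
  apply: contrapT => /forallNP nct.
  have /negP[] : ~~ (m * #|U|%:R * #|T|%:R <= \sum_t #|T|%:R * (c t)%:R :> R).
    rewrite -ltNge (_ : _ * _ * _ = \sum_(t : T) m * #|U|%:R); last first.
      by rewrite sumr_const mulr_natr.
    have /card_gt0P[t0 _] : (0 < #|T|)%N by rewrite -(ltr0n R).
    apply: ltr_sum => [|t _]; first by apply/hasP; exists t0; rewrite ?mem_index_enum.
    by rewrite ltNge; apply/negP; exact: nct.
  rewrite -mulr_sumr mulrC ler_pM2l // -natr_sum.
  have -> : (\sum_t c t = \sum_(i in U) #|H i|)%N.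
    rewrite (eq_bigr (fun t => \sum_(i in U) (t \in H i)))%N; last first.
      move=> t _; rewrite /c -sum1_card big_mkcond [RHS]big_mkcond /=.
      apply: eq_bigr => i _; rewrite inE.
      by case: (i \in U); case: (t \in H i).
    rewrite exchange_big /=; apply: eq_bigr => i _.
    by rewrite -sum1_card [RHS]big_mkcond; apply: eq_bigr => t _; case: ifP.
  rewrite natr_sum mulr_natr -sumr_const.
  by apply: ler_sum => i _.
exists (t |: S)%SET.
  by rewrite cardsU1 -add1n leq_add // leq_b1.
(* Adding [t] to [S] removes from the unhit sets exactly those containing [t]. *)
have -> : ([set i | [disjoint H i & t |: S]] = U :\: [set i in U | t \in H i])%SET.
  apply/setP => i; rewrite !inE !(disjoint_sym (H i)).
  rewrite !finset.disjoints_subset finset.subUset finset.sub1set inE.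
  by case: (t \in H i); case: (S \subset _).
have sU : [set i in U | t \in H i]%SET \subset U by apply/fintype.subsetP => i; rewrite inE => /andP[].
rewrite cardsDS // natrB ?subset_leq_card //.
rewrite exprSr mulrA -/(c t).
have q0 : 0 <= 1 - m / #|T|%:R by rewrite subr_ge0 ler_pdivrMr // mul1r.
apply: le_trans (ler_wpM2r q0 IH).
rewrite mulrBr mulr1 lerD2l lerN2 mulrA ler_pdivrMr //.
by rewrite [leLHS]mulrC [leRHS]mulrC.
Qed.

(** With [r] greedy rounds, [r] just above [#|T| / m * ln #|I|], the number of unhit sets is at most
    [#|I| * (1 - m / #|T|) ^+ r <= #|I| * expR (- (r * m / #|T|)) < 1], hence zero. *)
Lemma small_hitting_set (R : realType) (T I : finType) (H : I -> {set T})
    (m : R) (i0 : I) :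
  0 < m -> (forall i, m <= #|H i|%:R) ->
  exists2 S : {set T}, (forall i, exists2 t, t \in S & t \in H i) &
    #|S|%:R <= #|T|%:R / m * ln #|I|%:R + 1.
Proof.
move=> m0 mH.
have T0 : 0 < #|T|%:R :> R.
  by apply: lt_le_trans m0 (le_trans (mH i0) _); rewrite ler_nat max_card.
have I0 : (0 < #|I|)%N by apply/card_gt0P; exists i0.
set b := #|T|%:R / m * ln #|I|%:R.
have b0 : 0 <= b by rewrite mulr_ge0 ?ln_ge0 ?ler1n // divr_ge0 // ltW.
have /andP[rb br] := truncn_itv b0.
have [S Sr HS] := greedy_hitting (Num.truncn b).+1 i0 m0 mH.
exists S; last by apply: le_trans (_ : (Num.truncn b).+1%:R <= _); rewrite ?ler_nat // -natr1 lerD2r.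
move=> i; suff /pred0Pn[t /andP[tH tS]] : ~~ [disjoint H i & S] by exists t.
apply/negP => Hi.
have : 1 <= #|[set i | [disjoint H i & S]]%SET|%:R :> R.
  by rewrite ler1n; apply/card_gt0P; exists i; rewrite inE.
apply/negP; rewrite -ltNge; apply: le_lt_trans HS _.
have q0 : 0 <= 1 - m / #|T|%:R.
  rewrite subr_ge0 ler_pdivrMr // mul1r (le_trans (mH i0)) //.
  by rewrite ler_nat max_card.
have /(lerXn2r (Num.truncn b).+1 q0) q1 : 1 - m / #|T|%:R <= expR (- (m / #|T|%:R)).
  exact: expR_ge1Dx.
apply: le_lt_trans (ler_wpM2l _ (q1 _)) _ => //; first by rewrite nnegrE expR_ge0.
rewrite -expRM_natl mulrN -[X in X * _]lnK ?posrE ?ltr0n // -expRD expR_lt1.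
rewrite subr_lt0 mulrA ltr_pdivlMr // -ltr_pdivrMr //.
by rewrite (_ : _ / m = b) // /b [RHS]mulrC mulrA.
Qed.

(** * Grids, nets and the hitting construction at a single scale *)

Lemma closed_cube_dist (R : realType) (d : nat) (a x y : 'rV[R]_d) (s : R) :
  0 <= s -> closed_cube a s x -> closed_cube a s y -> `|x - y| <= s.
Proof.
move=> s0 xs ys; apply: norm_le_coord => // i; rewrite !mxE ler_norml.
by have /andP[? ?] := xs i; have /andP[? ?] := ys i; apply/andP; split; lra.
Qed.

Lemma closed_cube_enlarge (R : realType) (d : nat) (a x y : 'rV[R]_d) (s r : R) :
  closed_cube a s x -> `|y - x| <= r ->
  closed_cube (a - const_mx r) (s + r *+ 2) y.
Proof.
move=> xs yx i; have := le_trans (coord_le_norm (y - x) i) yx.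
rewrite !mxE ler_norml => /andP[? ?]; have /andP[? ?] := xs i.
by apply/andP; split; lra.
Qed.

Lemma closed_cube_widen (R : realType) (d : nat) (a x : 'rV[R]_d) (s r : R) :
  s <= r -> closed_cube a s x -> closed_cube a r x.
Proof.
by move=> sr xs i; have /andP[? ?] := xs i; apply/andP; split; lra.
Qed.

(** A point of the box is indexed by the integer parts of its coordinates, measured from [lo] in
    units of [w]; [w <= 1] absorbs the extra cell per axis into the [+ 1]. *)
Lemma grid_cells (R : realType) (d : nat) (lo hi w : R) :
  0 < w <= 1 -> lo <= hi ->
  exists (T : finType) (cell : 'rV[R]_d -> T) (corner : T -> 'rV[R]_d),
    #|T|%:R <= ((hi - lo + 1) / w) ^+ d /\
    forall y : 'rV[R]_d, (forall i, lo <= y ord0 i <= hi) ->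
      closed_cube (corner (cell y)) w y.
Proof.
move=> /andP[w0 w1] lohi; pose K := Num.truncn ((hi - lo) / w).
exists {ffun 'I_d -> 'I_K.+1}.
exists (fun y => [ffun i => inord (Num.truncn ((y ord0 i - lo) / w))]).
exists (fun t : {ffun 'I_d -> 'I_K.+1} => \row_i (lo + w * (t i)%:R)); split=> [|y ylh i].
  rewrite card_ffun !card_ord natrX lerXn2r ?nnegrE //.
    by apply: divr_ge0; lra.
  have /truncn_itv/andP[Kw _] : 0 <= (hi - lo) / w.
    by rewrite divr_ge0 ?subr_ge0 // ltW.
  rewrite -natr1 mulrDl mul1r lerD // -[leLHS]invr1 lef_pV2 ?posrE //.
have /andP[yl yh] := ylh i.
have u0 : 0 <= (y ord0 i - lo) / w by rewrite divr_ge0 ?subr_ge0 // ltW.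
rewrite !mxE ffunE inordK; last first.
  by rewrite ltnS le_truncn // ler_pM2r ?invr_gt0 // lerB.
have /andP[tl th] := truncn_itv u0.
move: tl th; set m := Num.truncn _; rewrite -(natr1 m).
rewrite ler_pdivlMr // ltr_pdivrMr // mulrDl mul1r => tl th.
by apply/andP; split; rewrite mulrC; lra.
Qed.

Lemma unit_cube_net (R : realType) (d : nat) (w : R) :
  0 < w <= 1 ->
  exists (J : finType) (zs : J -> 'rV[R]_d) (j0 : J),
    [/\ #|J|%:R <= (2 / w) ^+ d, forall j, unit_cube d (zs j) &
        forall z, unit_cube d z -> exists j, `|z - zs j| <= w].
Proof.
move=> w01; have [T [cell [corner [cT HT]]]] := grid_cells d w01 ler01.
have u0 : unit_cube d (0 : 'rV[R]_d) by move=> i; rewrite mxE lexx ler01.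
(* One point per grid cell; the default [0] still lies in the unit cube when a cell misses it. *)
pose rep t := xget (0 : 'rV[R]_d) [set z | unit_cube d z /\ cell z = t].
exists T, rep, (cell 0); split=> [|t|z zu].
- by rewrite (_ : 2 = 1 - 0 + 1 :> R) //; ring.
- by rewrite /rep; case: xgetP => [z _ []|].
have [ru rz] : unit_cube d (rep (cell z)) /\ cell (rep (cell z)) = cell z.
  by rewrite /rep; case: xgetP => [? _ //|/(_ z)[]].
exists (cell z); apply: (closed_cube_dist (a := corner (cell z))).
- by have /andP[/ltW] := w01.
- exact: HT.
- by have := HT _ ru; rewrite rz.
Qed.

(* P holds corners of the enlarged chosen cells, X witnesses in E for the hits. *)
Lemma hit_at_scale (R : realType) (d k : nat) (C b delta n : R)
    (E : set 'rV[R]_d) (fs : 'I_k -> 'rV[R]_d -> 'rV[R]_d) :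
  (0 < d)%N -> (0 < k)%N -> 1 <= C -> 0 <= b -> 0 < delta <= 1 -> 0 < n ->
  E `<=` unit_cube d ->
  (forall i x y, unit_cube d x -> unit_cube d y ->
     C^-1 * `|x - y| <= `|fs i x - fs i y|) ->
  (forall i x, unit_cube d x -> `|fs i x| <= b) ->
  (forall m, covered_by_balls E (C * delta) m -> n <= m%:R) ->
  exists P X : seq 'rV[R]_d,
    [/\ (size P)%:R <= (((2 * b + 3) * d%:R / delta) ^+ d / n) *
          ln (k%:R * (2 * d%:R / delta) ^+ d) + 1,
        forall x, x \in X -> E x &
        forall i z, unit_cube d z -> exists p x, [/\ p \in P, x \in X &
          forall y, `|y - (z - fs i x)| <= 2 * delta ->
            closed_cube p (7 * delta) y]].
Proof.
move=> d0 k0 C1 b0 /andP[de0 de1] n0 Eu fsC fsb En.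
have dR : 1 <= d%:R :> R by rewrite ler1n.
have dR0 : 0 < d%:R :> R by rewrite ltr0n.
have C0 : 0 < C by exact: lt_le_trans C1.
pose w := delta / d%:R.
have w0 : 0 < w by rewrite divr_gt0.
have wde : w <= delta by rewrite ler_pdivrMr // ler_peMr // ltW.
have w01 : 0 < w <= 1 by rewrite w0 (le_trans wde).
have [J [zs [j0 [cJ zsu zsP]]]] := unit_cube_net d w01.
have lohi : - (b + 1) <= b + 1 by lra.
have [T [cell [corner [cT HT]]]] := grid_cells d w01 lohi.
have box i j x : unit_cube d x ->
    forall l, - (b + 1) <= (zs j - fs i x) ord0 l <= b + 1.
  move=> xu l; rewrite !mxE.
  have /andP[? ?] := zsu j l.
  have := le_trans (coord_le_norm (fs i x) l) (fsb i x xu).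
  by rewrite ler_norml => /andP[? ?]; apply/andP; split; lra.
(* The cells met by [z - f(E)], for [f] in the finite family and [z] in the net. *)
pose H (q : 'I_k * J) : {set T} :=
  [set t | `[< exists2 x, E x & cell (zs q.2 - fs q.1 x) = t >]]%SET.
(* Choose one point of [E] for each cell of [H q]. Points of [E] sent to the same cell have images
   within [w = delta / d], so they are within [C * delta / d] of each other, and the Euclidean balls
   of radius [C * delta] about the chosen points cover [E]. *)
have nH q : n <= #|H q|%:R.
  apply: En.
  have Hx (t : T) : exists x, t \in H q -> E x /\ cell (zs q.2 - fs q.1 x) = t.
    have [|tH] := pselect (t \in H q); last by exists 0 => /tH.
    by rewrite inE => /asboolP[x Ex xt]; exists x.
  have [x_ x_P] := choice Hx.
  exists (fun l => x_ (enum_val l)) => x Ex /=.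
  pose t := cell (zs q.2 - fs q.1 x).
  have tH : t \in H q by rewrite inE; apply/asboolP; exists x.
  exists (enum_rank_in tH t); rewrite enum_rankK_in //.
  have [Ext xtE] := x_P t tH.
  apply: norm_le_euclid_ball => //.
  have := fsC q.1 x (x_ t) (Eu _ Ex) (Eu _ Ext).
  rewrite mulrC ler_pdivrMr // => /le_trans; apply.
  rewrite mulrC -mulrA ler_pM2l // -/w.
  have -> : fs q.1 x - fs q.1 (x_ t) =
      (zs q.2 - fs q.1 (x_ t)) - (zs q.2 - fs q.1 x).
    by apply/rowP => l; rewrite !mxE; ring.
  apply: (closed_cube_dist (a := corner t)); first exact: ltW.
    by have := HT _ (box q.1 q.2 _ (Eu _ Ext)); rewrite xtE.
  by apply: HT; apply: box; exact: Eu.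
have [S SH cS] := small_hitting_set (Ordinal k0, j0) n0 nH.
have Hx (q : 'I_k * J) : exists x, E x /\ cell (zs q.2 - fs q.1 x) \in S.
  by have [t tS] := SH q; rewrite inE => /asboolP[x Ex xt]; exists x; rewrite xt.
have [x_ x_P] := choice Hx.
exists [seq corner t - const_mx (3 * delta) | t <- enum S], (codom x_).
split=> [|x /codomP[q ->]|i z /zsP[j zj]]; last 2 first.
- by have [] := x_P q.
- have [Ex xS] := x_P (i, j).
  exists (corner (cell (zs j - fs i (x_ (i, j)))) - const_mx (3 * delta)), (x_ (i, j)).
  split=> [||y yz]; first by apply: map_f; rewrite mem_enum.
    exact: codom_f.
  (* The tolerance [2 * delta] plus the net error [w <= delta] displaces [y] by at most [3 * delta];
     the enlarged side is [w + 6 * delta <= 7 * delta]. *)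
  apply: (@closed_cube_widen _ _ _ _ (w + (3 * delta) *+ 2)).
    by rewrite -mulr_natr; lra.
  apply: (closed_cube_enlarge (HT _ (box i j _ (Eu _ Ex)))).
  set u := fs i _ in yz *.
  have -> : y - (zs j - u) = (y - (z - u)) + (z - zs j).
    by apply/rowP => l; rewrite !mxE; ring.
  by apply: le_trans (ler_normD _ _) _; lra.
rewrite size_map -cardE; apply: le_trans cS _; rewrite lerD2r.
have I1 : 1 <= #|{: 'I_k * J}|%:R :> R.
  by rewrite ler1n; apply/card_gt0P; exists (Ordinal k0, j0).
apply: ler_pM; rewrite ?divr_ge0 ?ln_ge0 ?(ltW n0) //.
  rewrite ler_pM2r ?invr_gt0 //; apply: le_trans cT _.
  rewrite /w invf_div mulrA (_ : b + 1 - - (b + 1) + 1 = 2 * b + 3) //; ring.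
rewrite ler_ln ?posrE.
- rewrite card_prod card_ord natrM ler_wpM2l //.
  by apply: le_trans cJ _; rewrite /w invf_div mulrA.
- exact: lt_le_trans I1.
- by rewrite mulr_gt0 ?ltr0n // exprn_gt0 // divr_gt0 // mulr_gt0.
Qed.

(** The powers of [delta] cancel in the main term, leaving a constant times a logarithm over [n].
    The hypothesis [1 <= ln delta^-1] lets [ln (delta^-1 * M)] absorb all terms of that logarithm.
    The rounding [+ 1] costs one cube, of volume at most [eps / 2]. *)
Lemma scale_volume (R : realType) (d k M : nat) (A B delta n eps s : R) :
  (0 < d)%N -> (0 < k <= M)%N -> 0 <= A -> 1 <= B ->
  0 < delta -> 1 <= ln delta^-1 -> 7 * delta <= 1 -> 7 * delta <= eps / 2 ->
  0 < n ->
  2 * ((7 * A) ^+ d * (d%:R + d%:R * ln B)) * ln (delta^-1 * M%:R) <= eps * n ->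
  s <= ((A / delta) ^+ d / n) * ln (k%:R * (B / delta) ^+ d) + 1 ->
  s * (7 * delta) ^+ d <= eps.
Proof.
move=> d0 /andP[k0 kM] A0 B1 de0 lnde de7 de7e n0 nP sle.
have k1 : 1 <= k%:R :> R by rewrite ler1n.
have M1 : k%:R <= M%:R :> R by rewrite ler_nat.
have d1 : 1 <= d%:R :> R by rewrite ler1n.
have lnB : 0 <= ln B by exact: ln_ge0.
have lnk : 0 <= ln (k%:R : R) by exact: ln_ge0.
have lnkM : ln (k%:R : R) <= ln M%:R by rewrite ler_ln ?posrE //; lra.
have LE : ln (delta^-1 * M%:R) = ln delta^-1 + ln M%:R.
  by rewrite lnM ?posrE ?invr_gt0 //; lra.
have lnle : ln (k%:R * (B / delta) ^+ d) <=
    (d%:R + d%:R * ln B) * ln (delta^-1 * M%:R).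
  have Bde : 0 < B / delta by rewrite divr_gt0 //; lra.
  rewrite lnM ?posrE ?exprn_gt0 //; last lra.
  rewrite lnXn // lnM ?posrE ?invr_gt0 //; last lra.
  rewrite LE -[X in _ + X]mulr_natl.
  (* These two nonnegative products are the nonlinear facts that [nra] combines. *)
  have ? : 0 <= (d%:R - 1) * ln (M%:R : R) by apply: mulr_ge0; lra.
  have ? : 0 <= (d%:R * ln B) * (ln delta^-1 + ln M%:R - 1).
    by rewrite !mulr_ge0 //; lra.
  nra.
have e0 : 0 <= (7 * delta) ^+ d by rewrite exprn_ge0 //; lra.
apply: le_trans (ler_wpM2r e0 sle) _; rewrite mulrDl mul1r.
have e1 : (7 * delta) ^+ d <= eps / 2.
  apply: le_trans de7e; case: d d0 {nP sle d1 lnle e0} => // d' _.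
  rewrite exprS ler_piMr ?exprn_ile1 //; lra.
have -> : (A / delta) ^+ d / n * ln (k%:R * (B / delta) ^+ d) * (7 * delta) ^+ d
    = (7 * A) ^+ d * ln (k%:R * (B / delta) ^+ d) / n.
  have -> : (7 * A) ^+ d = (A / delta) ^+ d * (7 * delta) ^+ d.
    by rewrite -exprMn; congr (_ ^+ _); field; rewrite gt_eqF.
  ring.
have : (7 * A) ^+ d * ln (k%:R * (B / delta) ^+ d) / n <= eps / 2.
  rewrite ler_pdivrMr //.
  have A7 : 0 <= (7 * A) ^+ d by rewrite exprn_ge0 //; lra.
  have := ler_wpM2l A7 lnle; nra.
lra.
Qed.

(** * Covers of the family, uniform bounds and small cubes *)

Lemma near0_right (R : realType) (P : R -> Prop) :
  (\forall x \near 0^'+, P x) ->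
  exists2 eta : R, 0 < eta & forall x, 0 < x < eta -> P x.
Proof.
move=> /nbhs_ballP[eta /= eta0 H]; exists eta => // x /andP[x0 xeta].
by apply: H => //=; rewrite /ball /= sub0r normrN gtr0_norm.
Qed.

(** An infimum of integers below [m + 1] is witnessed by some [k <= m]; a nonempty family forces
    [0 < k]. *)
Lemma fam_covnum_cover (R : realType) (d m : nat)
    (F : set ('rV[R]_d -> 'rV[R]_d)) (delta : R) :
  F !=set0 -> (fam_covnum F delta <= (m%:R)%:E)%E ->
  exists2 k, (0 < k <= m)%N & fam_covered_by F delta k.
Proof.
move=> [f Ff] Fm.
have : (fam_covnum F delta < (m.+1%:R)%:E)%E.
  by apply: le_lt_trans Fm _; rewrite lte_fin ltr_nat.
move=> /ereal_inf_lt[_ [k Fk <-]]; rewrite lte_fin ltr_nat ltnS => km.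
exists k => //; rewrite km andbT.
by case: Fk => fs [_ /(_ f Ff)[[i ik] _]]; exact: leq_ltn_trans ik.
Qed.

(** Finitely many centres are bounded at [0], hence on the unit cube by the Lipschitz bound, and
    every [f] is within [delta] of one of them. *)
Lemma family_bounded (R : realType) (d k : nat)
    (F : set ('rV[R]_d -> 'rV[R]_d)) (delta : R) :
  (forall f, F f -> forall x y, unit_cube d x -> unit_cube d y ->
     `|f x - f y| <= `|x - y|) ->
  fam_covered_by F delta k ->
  exists2 b, 0 <= b &
    forall f, F f -> forall x, unit_cube d x -> `|f x| <= b.
Proof.
move=> Flip [fs [Ffs Fcov]].
have [b b0 fsb] := finite_bound (fun i => `|fs i 0|).
exists (`|delta| + 1 + b) => [|f Ff x xu]; first by rewrite !addr_ge0.
have [i fi] := Fcov f Ff.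
have u0 : unit_cube d (0 : 'rV[R]_d) by move=> l; rewrite mxE lexx ler01.
have x1 : `|x - 0| <= 1.
  rewrite subr0; apply: norm_le_coord => // l.
  by have /andP[? ?] := xu l; rewrite ger0_norm.
have := Flip _ (Ffs i) _ _ xu u0.
have -> : f x = (f x - fs i x) + (fs i x - fs i 0) + fs i 0.
  by apply/rowP => l; rewrite !mxE; ring.
move=> fix0; apply: le_trans (ler_normD _ _) _; apply: lerD (fsb i).
apply: le_trans (ler_normD _ _) _; apply: lerD; last exact: le_trans x1.
exact: le_trans (fi x xu) (ler_norm _).
Qed.

Lemma interior_closed_cube_center (R : realType) (d : nat) (x : 'rV[R]_d) (r : R) :
  0 < r -> interior (closed_cube (x - const_mx (r / 2)) r) x.
Proof.
move=> r0; apply/nbhs_ballP; exists (r / 2) => /=; first by rewrite divr_gt0.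
move=> y; rewrite -ball_normE /= => xy i.
have := le_trans (coord_le_norm (x - y) i) (ltW xy).
by rewrite !mxE ler_norml => /andP[? ?]; apply/andP; split; lra.
Qed.

Lemma closed_cube_inside (R : realType) (d : nat) (U : set 'rV[R]_d)
    (x : 'rV[R]_d) (delta : R) :
  0 < delta -> interior U x ->
  exists r, [/\ 0 < r, r <= delta & closed_cube (x - const_mx (r / 2)) r `<=` U].
Proof.
move=> de0 /nbhs_ballP[e /= e0 xU]; exists (Num.min delta (e / 2)).
set r := Num.min _ _.
have rde : r <= delta by rewrite ge_min lexx.
have re : r <= e / 2 by rewrite ge_min lexx orbT.
have r0 : 0 < r by rewrite lt_min de0 divr_gt0.
split=> // y yr; apply: xU; rewrite -ball_normE /=.
apply: le_lt_trans (_ : r < _); last lra.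
apply: (closed_cube_dist (ltW r0) _ yr).
exact: interior_subset (interior_closed_cube_center x r0).
Qed.

(** * Refinement of lists of cubes *)

Definition cell (R : realType) (d : nat) (q : 'rV[R]_d * R) : set 'rV[R]_d :=
  interior (closed_cube q.1 q.2).

Definition meets (R : realType) (d : nat) (A : set 'rV[R]_d)
    (L : seq ('rV[R]_d * R)) : Prop :=
  forall q, q \in L -> 0 < q.2 /\ (A `&` cell q) !=set0.

Definition total_volume_le (R : realType) (d : nat) (eps : R)
    (D : seq ('rV[R]_d * R)) : Prop :=
  all (fun q => 0 <= q.2) D /\ \sum_(q <- D) q.2 ^+ d <= eps.

(** The new cube may depend on [f] and [z], while [D] serves all of them. The inclusion into
    [cell q] makes the conclusions of earlier stages pass to later ones. *)
Definition refines (R : realType) (d : nat) (F : set ('rV[R]_d -> 'rV[R]_d))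
    (A : set 'rV[R]_d) (L L' D : seq ('rV[R]_d * R)) : Prop :=
  forall f z q, F f -> unit_cube d z -> q \in L ->
    exists q', [/\ q' \in L', A `&` cell q' `<=` cell q &
      forall x, A x -> cell q' x -> cubes_union D (z - f x)].

Lemma refine_one (R : realType) (d : nat) (C : R) (N M : R -> nat)
    (F : set ('rV[R]_d -> 'rV[R]_d)) (A : set 'rV[R]_d) (q : 'rV[R]_d * R)
    (eps : R) :
  (0 < d)%N -> 1 <= C ->
  (((N (C * x))%:R : R) / ln (x^-1 * (M x)%:R) @[x --> 0^'+] --> +oo) ->
  (forall f, F f -> forall x y, unit_cube d x -> unit_cube d y ->
     C^-1 * `|x - y| <= `|f x - f y| <= `|x - y|) ->
  (\forall delta \near 0^'+, (fam_covnum F delta <= ((M delta)%:R)%:E)%E) ->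
  F !=set0 -> A `<=` unit_cube d ->
  limsup_at0_ge1 (fun delta =>
    (ball_covnum (A `&` cell q) delta * ((N delta)%:R^-1)%:E)%E) ->
  0 < eps ->
  exists D L' : seq ('rV[R]_d * R),
    [/\ total_volume_le eps D, meets A L' & refines F A [:: q] L' D].
Proof.
move=> d0 C1 /cvgryPgt NM Fbi Fcov F0 Au Elarge eps0.
have C0 : 0 < C by exact: lt_le_trans C1.
have dR : 1 <= d%:R :> R by rewrite ler1n.
have Flip f : F f -> forall x y, unit_cube d x -> unit_cube d y ->
    `|f x - f y| <= `|x - y|.
  by move=> Ff x y xu yu; have /andP[] := Fbi f Ff x y xu yu.
have [b b0 Fb] : exists2 b, 0 <= b &
    forall f, F f -> forall x, unit_cube d x -> `|f x| <= b.
  have [eta eta0 /(_ (eta / 2))] := near0_right Fcov.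
  case/(_ _)/(fam_covnum_cover F0); first lra.
  by move=> k _; exact: family_bounded.
pose a := (2 * b + 3) * d%:R; pose B := 2 * d%:R : R.
pose P := (7 * a) ^+ d * (d%:R + d%:R * ln B).
have [eta1 eta10 cov1] := near0_right Fcov.
(* The factor 4 is 2 from [scale_volume] times 2 from [n = N Delta / 2]. *)
have [eta2 eta20 NM2] := near0_right (NM (4 * P / eps)).
(* Below [eta]: the family has its cover, the ratio is large, [1 <= ln delta^-1], [7 * delta <= 1]
   and [7 * delta <= eps / 2]. *)
pose eta := Num.min (Num.min eta1 eta2)
  (Num.min (expR (- 1)) (Num.min (1 / 7) (eps / 14))).
have eta0 : 0 < eta by rewrite !lt_min eta10 eta20 expR_gt0 /=; lra.
have Ceta0 : 0 < C * eta by rewrite mulr_gt0.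
have half0 : 0 < 2^-1 :> R by rewrite invr_gt0.
(* The limsup with tolerance 1/2 gives a covering number above [N Delta / 2]; taking
   [Delta < C * eta] puts [Delta / C] below [eta]. *)
have [Delta [/andP[De0 Deeta] [De1 NDe]]] := Elarge _ half0 _ Ceta0.
pose delta := Delta / C.
have CdeE : C * delta = Delta by rewrite /delta; field; rewrite gt_eqF.
have de0 : 0 < delta by rewrite divr_gt0.
have : delta < eta by rewrite ltr_pdivrMr // mulrC.
rewrite !lt_min => /andP[/andP[de_1 de_2] /andP[de_e /andP[de7 de_eps]]].
have lnde : 1 <= ln delta^-1.
  rewrite lnV ?posrE // lerNr -[X in _ <= X](expRK (- 1)) ler_ln ?posrE ?expR_gt0 //.
  exact: ltW.
have [k /andP[k0 kM] [fs [Ffs fscov]]] : exists2 k, (0 < k <= M delta)%N &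
    fam_covered_by F delta k.
  by apply: fam_covnum_cover => //; apply: cov1; rewrite de0.
have M1 : 1 <= (M delta)%:R :> R by rewrite ler1n (leq_trans k0).
have ln0 : 0 < ln (delta^-1 * (M delta)%:R).
  rewrite lnM ?posrE ?invr_gt0 //; last lra.
  by have := ln_ge0 M1; lra.
have NP : 4 * P / eps * ln (delta^-1 * (M delta)%:R) < (N Delta)%:R.
  by rewrite -ltr_pdivlMr // -CdeE; apply: NM2; rewrite de0.
have ND0 : 0 < (N Delta)%:R :> R.
  (* If [N Delta] were 0, the quotient would be 0 by the convention on inverses, contradicting the
     bound 1/2. *)
  rewrite lt_neqAle ler0n andbT; apply/eqP => N0.
  by move: NDe; rewrite -N0 invr0 mule0 lte_fin; lra.
pose E := A `&` cell q.
have En m : covered_by_balls E (C * delta) m -> (N Delta)%:R / 2 <= m%:R :> R.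
  rewrite CdeE => Em.
  have : (ball_covnum E Delta <= (m%:R)%:E)%E.
    by apply: ereal_inf_lbound; exists m.
  move: NDe; rewrite lte_pdivlMr // => /lt_le_trans/[apply].
  by rewrite -EFinM lte_fin => ?; lra.
have de01 : 0 < delta <= 1 by rewrite de0; lra.
have n0 : 0 < (N Delta)%:R / 2 :> R by lra.
have Eu : E `<=` unit_cube d by move=> x [/Au].
have fsC i x y : unit_cube d x -> unit_cube d y ->
    C^-1 * `|x - y| <= `|fs i x - fs i y|.
  by move=> xu yu; have /andP[] := Fbi _ (Ffs i) x y xu yu.
have [Ps [X [Psize XE HX]]] := hit_at_scale d0 k0 C1 b0 de01 n0 Eu fsC
  (fun i => Fb _ (Ffs i)) En.
(* Each witness gets a cube of side at most [delta] inside the old one; these form the new list. *)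
have rP (x : 'rV[R]_d) : exists r, E x -> [/\ 0 < r, r <= delta &
    closed_cube (x - const_mx (r / 2)) r `<=` closed_cube q.1 q.2].
  have [Ex|nEx] := pselect (E x); last by exists 0.
  by have [r rx] := closed_cube_inside de0 Ex.2; exists r.
have [r_ r_P] := choice rP.
exists [seq (p, 7 * delta) | p <- Ps].
exists [seq (x - const_mx (r_ x / 2), r_ x) | x <- X].
split.
- split; first by rewrite all_map; apply/allP => p _ /=; lra.
  rewrite big_map /= big_const_seq count_predT iter_addr_0.
  have kMd : (0 < k <= M delta)%N by rewrite k0.
  have a0 : 0 <= a by rewrite mulr_ge0 //; lra.
  have B1 : 1 <= B by rewrite /B; lra.
  rewrite -[leLHS]mulr_natl.
  apply: (scale_volume d0 kMd a0 B1 de0 lnde _ _ n0 _ Psize); [lra|lra|].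
  rewrite -/P; move: NP; rewrite mulrAC ltr_pdivrMr // => NP; lra.
- move=> _ /mapP[x xX ->] /=.
  have [r0 rde rq] := r_P x (XE x xX).
  split=> //; exists x; split; first by have [] := XE x xX.
  exact: interior_closed_cube_center.
move=> f z q' Ff zu; rewrite inE => /eqP ->{q'}.
have [i fi] := fscov f Ff.
have [p [x [pP xX px]]] := HX i z zu.
have [r0 rde rq] := r_P x (XE x xX).
exists (x - const_mx (r_ x / 2), r_ x); split.
- by apply/mapP; exists x.
- by move=> y [_ /=]; exact: (interiorS rq).
move=> y Ay /interior_subset /= yx.
exists (p, 7 * delta); first by apply/mapP; exists p.
apply: px.
have xu : unit_cube d x by exact: Eu (XE x xX).
have xy : `|x - y| <= r_ x.
  apply: (closed_cube_dist (ltW r0) _ yx).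
  exact: interior_subset (interior_closed_cube_center x r0).
(* The two differences are at most [r_ x <= delta] and [delta], within the tolerance [2 * delta] of
   [hit_at_scale]. *)
have -> : z - f y - (z - fs i x) = (f x - f y) - (f x - fs i x).
  by apply/rowP => l; rewrite !mxE; ring.
apply: le_trans (ler_normB _ _) _.
have := fi x xu; have := Flip f Ff x y xu (Au y Ay).
lra.
Qed.

(** Induction on the list: the head and the tail each get half of [eps], and both outputs are
    concatenated, so each cube may use its own scale. *)
Lemma refine_list (R : realType) (d : nat) (F : set ('rV[R]_d -> 'rV[R]_d))
    (A : set 'rV[R]_d) :
  (forall q eps, 0 < eps -> 0 < q.2 -> (A `&` cell q) !=set0 ->
    exists D L' : seq ('rV[R]_d * R),
      [/\ total_volume_le eps D, meets A L' & refines F A [:: q] L' D]) ->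
  forall L eps, 0 < eps -> meets A L ->
    exists D L' : seq ('rV[R]_d * R),
      [/\ total_volume_le eps D, meets A L' & refines F A L L' D].
Proof.
move=> one; elim=> [|q L IH] eps eps0 AL.
  exists [::], [::]; split=> //; split=> //; by rewrite big_nil ltW.
have e2 : 0 < eps / 2 by rewrite divr_gt0.
have [q0 qA] := AL q (mem_head _ _).
have [D1 [L1 [[D1p D1v] AL1 r1]]] := one q _ e2 q0 qA.
have [||D2 [L2 [[D2p D2v] AL2 r2]]] := IH (eps / 2); first by [].
  by move=> p pL; apply: AL; rewrite inE pL orbT.
exists (D1 ++ D2), (L1 ++ L2); split.
- by split; [rewrite all_cat D1p | rewrite big_cat /=; lra].
- by move=> p; rewrite mem_cat => /orP[/AL1|/AL2].
move=> f z p Ff zu; rewrite inE => /orP[/eqP ->|pL].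
  have [q' [q'L q'q q'D]] := r1 f z q Ff zu (mem_head _ _).
  exists q'; split=> [||x Ax /(q'D _ Ax)]; rewrite ?mem_cat ?q'L //.
  by rewrite cubes_union_cat; left.
have [q' [q'L q'q q'D]] := r2 f z p Ff zu pL.
exists q'; split=> [||x Ax /(q'D _ Ax)]; rewrite ?mem_cat ?q'L ?orbT //.
by rewrite cubes_union_cat; right.
Qed.

(** * Passage to the limit *)

(** The step is iterated with volumes [1 / (n + 1)]. For fixed [f] and [z], nested cubes give [x_ n]
    in [A] with [z - f (x_ n)] in [D k] for all [k < n]. A cluster point [a] of [x_] exists by
    compactness, and since the [D k] are closed and [f] is continuous on the unit cube, [z - f a]
    lies in every [D k]. *)
Lemma refinement_limit (R : realType) (d : nat)
    (F : set ('rV[R]_d -> 'rV[R]_d)) (A : set 'rV[R]_d) :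
  (0 < d)%N -> compact A -> A !=set0 -> A `<=` unit_cube d ->
  (forall f, F f -> forall x y, unit_cube d x -> unit_cube d y ->
     `|f x - f y| <= `|x - y|) ->
  (forall L eps, 0 < eps -> meets A L ->
    exists D L' : seq ('rV[R]_d * R),
      [/\ total_volume_le eps D, meets A L' & refines F A L L' D]) ->
  exists B : set 'rV[R]_d,
    [/\ compact B, lebesgue_null B &
      forall f, F f -> forall z, unit_cube d z ->
        exists a b, [/\ A a, B b & z = f a + b]].
Proof.
move=> d0 Ac A0 Au Flip step.
pose state := {L : seq ('rV[R]_d * R) | meets A L}.
have next (p : nat * state) : exists r : seq ('rV[R]_d * R) * state,
    total_volume_le (p.1.+1%:R^-1) r.1 /\
    refines F A (sval p.2) (sval r.2) r.1.
  have [D [L' [Dv AL' rL']]] :=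
    step (sval p.2) p.1.+1%:R^-1 ltac:(by rewrite invr_gt0) (svalP p.2).
  by exists (D, exist _ L' AL').
have [nx nxP] := choice next.
(* The initial cube [[-1, 2]^d] has the unit cube in its interior. *)
have S0P : meets A [:: (const_mx (- 1), 3)].
  move=> q; rewrite inE => /eqP -> /=; split=> //.
  have [x Ax] := A0; exists x; split=> //.
  apply/nbhs_ballP; exists 1 => //= y; rewrite -ball_normE /= => xy i.
  have := le_trans (coord_le_norm (x - y) i) (ltW xy).
  rewrite !mxE ler_norml => /andP[? ?]; have /andP[? ?] := Au x Ax i.
  by apply/andP; split; lra.
pose S := fix S n : state :=
  if n is m.+1 then (nx (m, S m)).2 else exist _ _ S0P.
pose D n := (nx (n, S n)).1.
have Dv n : total_volume_le (n.+1%:R^-1) (D n) by have [] := nxP (n, S n).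
have Sr n : refines F A (sval (S n)) (sval (S n.+1)) (D n).
  by have [] := nxP (n, S n).
have nest n f z : F f -> unit_cube d z ->
    exists2 q, q \in sval (S n) & forall x, A x -> cell q x ->
      forall k, (k < n)%N -> cubes_union (D k) (z - f x).
  move=> Ff zu; elim: n => [|n [q qS qD]].
    by exists (const_mx (- 1), 3) => //=; rewrite mem_head.
  have [q' [q'S q'q q'D]] := Sr n f z q Ff zu qS.
  exists q' => // x Ax q'x k; rewrite ltnS leq_eqVlt => /orP[/eqP ->|kn].
    exact: q'D.
  by apply: qD => //; exact: q'q.
exists (\bigcap_k cubes_union (D k)); split.
- apply: (@subclosed_compact _ _ (cubes_union (D 0%N))).
  + by apply: closed_bigI => k _; exact: cubes_union_closed.
  + exact: cubes_union_compact.
  + by move=> x; apply.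
- apply: lebesgue_null_cubes => // eps eps0.
  have [n ne] : exists n, n.+1%:R^-1 <= eps.
    have e0 : 0 < eps^-1 by rewrite invr_gt0.
    exists (Num.truncn eps^-1); rewrite -[leRHS]invrK lef_pV2 ?posrE //.
    by have /andP[_ /ltW] := truncn_itv (ltW e0).
  have [Dp Dvn] := Dv n.
  exists (D n); split=> //; first by move=> x; apply.
  exact: le_trans ne.
move=> f Ff z zu.
have xP n : exists x, A x /\ forall k, (k < n)%N -> cubes_union (D k) (z - f x).
  have [q qS qD] := nest n f z Ff zu.
  have [_ [x [Ax qx]]] := svalP (S n) q qS.
  by exists x; split=> // k; exact: qD.
have [x_ x_P] := choice xP.
have [|a [Aa xa]] := Ac (x_ @ \oo) _.
  by exists 0%N => // n _ /=; have [] := x_P n.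
exists a, (z - f a); split=> //; last by rewrite addrC subrK.
move=> k _; apply: cubes_union_closed => U /nbhs_ballP[e /= e0 eU].
(* The cluster point is tested against the tail of indices beyond [k], where membership in [D k] is
   known. *)
have [|_ [[n kn <-] axn]] := xa (x_ @` [set n | (k < n)%N]) (ball a e) _ (nbhsx_ballx _ _ e0).
  by exists k.+1 => // n /= kn; exists n.
exists (z - f (x_ n)); split; first by have [_] := x_P n; apply.
apply: eU; move: axn; rewrite -!ball_normE /=; apply: le_lt_trans.
have [Axn _] := x_P n.
have -> : z - f a - (z - f (x_ n)) = - (f a - f (x_ n)).
  by apply/rowP => l; rewrite !mxE; ring.
by rewrite normrN; apply: Flip => //; exact: Au.
Qed.

(** * Positive dimension and conclusion *)

(** In dimension 0 a single ball covers everything, so covering numbers are at most 1, while [N]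
    exceeds 2 at small scales and the limsup condition with tolerance 1/2 fails. *)
Lemma N_large_dim_gt0 (R : realType) (d : nat) (N : R -> nat)
    (A : set 'rV[R]_d) :
  (((N x)%:R : R) @[x --> 0^'+] --> +oo) -> N_large N A -> (0 < d)%N.
Proof.
case: d A => // A /cvgryPgt/(_ 2)/near0_right[eta eta0 Neta].
case=> A' [_ [x A'x] _ /(_ 0 1 ltr01)].
have cubeT (a : 'rV[R]_0) s : closed_cube a s = setT.
  by rewrite -subTset => y _ [].
rewrite cubeT interiorT setIT => /(_ (ex_intro _ x A'x)).
have half0 : 0 < 2^-1 :> R by rewrite invr_gt0.
move=> /(_ _ half0 _ eta0)[de [/andP[de0 deeta] [_]]].
have N2 : 2 < (N de)%:R :> R by apply: Neta; rewrite de0.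
rewrite lte_pdivlMr; last lra.
have : (ball_covnum A' de <= 1%:E)%E.
  apply: ereal_inf_lbound; exists 1%N => //.
  exists (fun=> 0) => y _; exists ord0.
  by rewrite /euclid_ball /= big_ord0 sqrtr0 ltW.
by move=> /(lt_le_trans _)/[apply]; rewrite -EFinM lte_fin => ?; lra.
Qed.

Theorem theorem3 (R : realType) (d : nat) (C : R) (N M : R -> nat)
  (F : set ('rV[R]_d -> 'rV[R]_d)) :
  1 <= C ->
  (((N x)%:R : R) @[x --> 0^'+] --> +oo) ->
  (((N (C * x))%:R : R) / ln (x^-1 * (M x)%:R) @[x --> 0^'+] --> +oo) ->
  (forall f, F f -> forall x y, unit_cube d x -> unit_cube d y ->
     C^-1 * `|x - y| <= `|f x - f y| <= `|x - y|) ->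
  (\forall delta \near 0^'+, (fam_covnum F delta <= ((M delta)%:R)%:E)%E) ->
  forall A : set 'rV[R]_d,
    borel_set A -> A `<=` unit_cube d -> N_large N A ->
    exists B : set 'rV[R]_d,
      [/\ compact B, lebesgue_null B &
        forall f, F f -> forall z, unit_cube d z ->
          exists a b, [/\ A a, B b & z = f a + b]].
Proof.
move=> C1 Ninf NM Fbi Fcov A _ Au Alarge.
have d0 : (0 < d)%N by exact: N_large_dim_gt0 Ninf Alarge.
have [A' [A'c A'0 A'A A'large]] := Alarge.
(* For an empty family the empty [B] works; otherwise the covers of the family have at least one
   centre. *)
have [F0|/set0P/negP/negPn/eqP F0] := pselect (F !=set0); last first.
  exists set0; split; first exact: compact0.
    apply: lebesgue_null_cubes => // eps eps0.
    by exists [::]; split=> //; rewrite big_nil ltW.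
  by rewrite F0.
have A'u : A' `<=` unit_cube d by exact: subset_trans Au.
have [||B [Bc Bnull HB]] := refinement_limit (F := F) d0 A'c A'0 A'u.
- by move=> f Ff x y xu yu; have /andP[] := Fbi f Ff x y xu yu.
- apply: refine_list => q eps eps0 q0 qA.
  exact: (refine_one d0 C1 NM Fbi Fcov F0 A'u (A'large _ _ q0 qA)).
exists B; split=> // f Ff z zu.
have [a [b [Aa Bb zE]]] := HB f Ff z zu.
by exists a, b; split=> //; exact: A'A.
Qed.
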